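(* Let $G=(V,E)$ be a signed graph which is a complete graph as a non-signed graph. Then $G$ is signed-eliminable if and only if for each $\sigma\in\{+,-\}$, the graph $G_\sigma$ contains, as an induced subgraph, neither a simple path with four vertices, nor a pair of two disjoint edges such that no vertex of one edge is joined by an edge of $G_\sigma$ to a vertex of the other edge.
   Context: All graphs are finite, simple and undirected. A signed graph is a graph $G=(V,E)$ together with a partition $E=E_+\sqcup E_-$ (either part may be empty); put $G_\sigma=(V,E_\sigma)$ for $\sigma\in\{+,-\}$, and let $-\sigma$ be the opposite sign. An ordering on $G$ is a bijection $\nu:V\to\{1,\dots,|V|\}$. It is a signed elimination ordering (SEO) if for every triple $(u,v,w)$ of distinct vertices with $\nu(u)<\nu(w)>\nu(v)$ and each $\sigma\in\{+,-\}$: (E1) if $uw,wv\in E_\sigma$ then $uv\in E_\sigma$; (E2) if $uv\in E_\sigma$ and $vw\in E_{-\sigma}$ then $uw\in E_\sigma$. $G$ is signed-eliminable if it admits a SEO. *)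

(* Defs.v *)
From mathcomp Require Import all_boot.

Set Implicit Arguments.
Unset Strict Implicit.
Unset Printing Implicit Defensive.

Record graph (V : finType) := Graph {
  adj :> rel V;
  adj_sym : symmetric adj;
  adj_irrefl : irreflexive adj
}.

(* Signs are booleans: + is true, - is false, and the opposite of s is ~~ s.
   The graph [part G s] is G_s = (V, E_s). *)
Definition sign := bool.

Record signed_graph (V : finType) := SignedGraph {
  unsigned : graph V;
  part : sign -> graph V;
  part_cover : forall u v, unsigned u v = part true u v || part false u v;
  part_disjoint : forall u v, ~~ (part true u v && part false u v)
}.

Definition complete_graph (V : finType) (G : graph V) : Prop :=
  forall u v : V, u != v -> G u v.

(* Orderings take values in {0, ..., |V| - 1} instead of {1, ..., |V|}; only
   comparisons of values are used. *)
Definition ordering (V : finType) (nu : V -> 'I_#|V|) : Prop := bijective nu.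

Definition SEO (V : finType) (G : signed_graph V) (nu : V -> 'I_#|V|) : Prop :=
  ordering nu /\
  forall u v w : V, uniq [:: u; v; w] -> nu u < nu w -> nu v < nu w ->
  forall s : sign,
    (part G s u w -> part G s w v -> part G s u v) /\
    (part G s u v -> part G (~~ s) v w -> part G s u w).

Definition signed_eliminable (V : finType) (G : signed_graph V) : Prop :=
  exists nu : V -> 'I_#|V|, SEO G nu.

Definition contains_induced (V W : finType) (G : graph V) (H : graph W) : Prop :=
  exists f : W -> V, injective f /\ forall x y : W, G (f x) (f y) = H x y.

Definition path_adj (n : nat) : rel 'I_n :=
  fun i j => (i.+1 == j :> nat) || (j.+1 == i :> nat).

Lemma path_adj_sym n : symmetric (@path_adj n).
Proof. by move=> i j; rewrite /path_adj orbC. Qed.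

Lemma path_adj_irrefl n : irreflexive (@path_adj n).
Proof. by move=> i; rewrite /path_adj orbb; apply/negbTE; rewrite gtn_eqF. Qed.

Definition path_graph (n : nat) : graph 'I_n :=
  Graph (@path_adj_sym n) (@path_adj_irrefl n).

(* Two disjoint edges ab and cd with no edge of G between them; the subgraph
   induced on {a, b, c, d} then consists of exactly these two edges. *)
Definition contains_induced_edge_pair (V : finType) (G : graph V) : Prop :=
  exists a b c d : V,
    [/\ G a b, G c d, [disjoint [set a; b] & [set c; d]] &
        forall x y : V, x \in [set a; b] -> y \in [set c; d] -> ~~ G x y].

(* Main.v *)
(** Signs on a complete graph satisfy (E1) and (E2) exactly when the edges from
    each vertex [w] to earlier vertices never form a triangle [uvw] with [uw]
    and [vw] of one sign and [uv] of the other.  Both sides of the equivalence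
    amount to the absence of an alternating 4-cycle [abcd], that is, one whose
    edges [ab], [cd] have one sign and [bc], [da] the other: depending on the
    signs of the diagonals, the four vertices of such a cycle induce a path or a
    pair of edges in one of the graphs [G_s], and conversely.  In an alternating
    cycle the last vertex violates (E1).  Without alternating cycles, every
    nonempty set of vertices has one whose edges to the rest all have the same
    sign; removing such vertices one after the other gives a SEO. *)

Require Import Defs.
From mathcomp Require Import all_boot.

Set Implicit Arguments.
Unset Strict Implicit.
Unset Printing Implicit Defensive.

Section SignedGraphs.
Variables (V : finType) (G : signed_graph V).

Lemma part_neq s u v : part G s u v -> u != v.
Proof. by apply: contraTneq => ->; rewrite adj_irrefl. Qed.

Lemma part_sign_inj s t u v : part G s u v -> part G t u v -> s = t.
Proof.
by have := part_disjoint G u v; case: s; case: t => // + uv1 uv2; rewrite uv1 uv2.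
Qed.

Definition alternating_cycle (s : sign) (a b c d : V) : Prop :=
  [/\ part G s a b, part G (~~ s) b c, part G s c d & part G (~~ s) d a].

Lemma alternating_cycle_rot s a b c d :
  alternating_cycle s a b c d -> alternating_cycle (~~ s) b c d a.
Proof. by case=> ab bc cd da; split; rewrite ?negbK. Qed.

(** Otherwise [ab] and [bc] would be one edge with two signs. Hence the diagonals are edges and
    carry signs. *)
Lemma alternating_cycle_diag s a b c d : alternating_cycle s a b c d -> a != c.
Proof.
case=> ab bc _ _; apply/eqP => ac; move: ab; rewrite ac adj_sym => cb.
by have := part_sign_inj cb bc; case: (s).
Qed.

Hypothesis complete_G : complete_graph (unsigned G).

Lemma partN s u v : u != v -> part G (~~ s) u v = ~~ part G s u v.
Proof.
move=> /complete_G; rewrite part_cover; have := part_disjoint G u v.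
by case: s => /=; case: (part G true u v); case: (part G false u v).
Qed.

(** The diagonal [ac] shares its sign with [ab] or with [da]; (E1) at [a] then gives [bc] or [cd]
    the wrong sign. *)
Lemma SEO_no_alternating_cycle_max (nu : V -> 'I_#|V|) s a b c d :
    SEO G nu -> alternating_cycle s a b c d ->
  ~ [/\ nu b <= nu a, nu c <= nu a & nu d <= nu a].
Proof.
case=> /bij_inj nu_inj seo abcd [ba ca da].
have ac := alternating_cycle_diag abcd.
case: abcd => [Eab Ebc Ecd Eda].
have lt_nu x : x != a -> nu x <= nu a -> nu x < nu a.
  by move=> xa; rewrite leq_eqVlt val_eqE (inj_eq nu_inj) (negbTE xa).
have neq_ba : b != a by rewrite eq_sym (part_neq Eab).
have neq_ca : c != a by rewrite eq_sym.
have neq_da := part_neq Eda.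
have neq_bc := part_neq Ebc; have neq_cd := part_neq Ecd.
case Eac: (part G s a c).
  have [|E1 _] := seo b c a _ (lt_nu _ neq_ba ba) (lt_nu _ neq_ca ca) s.
    by rewrite /= !inE negb_or neq_bc neq_ba neq_ca.
  have /part_sign_inj/(_ Ebc) : part G s b c by apply: E1; rewrite // adj_sym.
  by case: (s).
have [|E1 _] := seo d c a _ (lt_nu _ neq_da da) (lt_nu _ neq_ca ca) (~~ s).
  by rewrite /= !inE negb_or eq_sym neq_cd neq_da neq_ca.
have Edc : part G (~~ s) d c by apply: E1; rewrite // partN // Eac.
by move: Ecd; rewrite adj_sym => /part_sign_inj/(_ Edc); case: (s).
Qed.

Lemma SEO_no_alternating_cycle (nu : V -> 'I_#|V|) s a b c d :
  SEO G nu -> ~ alternating_cycle s a b c d.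
Proof.
move=> seo abcd.
have bcda := alternating_cycle_rot abcd.
have cdab := alternating_cycle_rot bcda.
have dabc := alternating_cycle_rot cdab.
have nmax := SEO_no_alternating_cycle_max seo.
(* Some rotation of the cycle starts at its last vertex. *)
case: (arg_maxnP (P := mem [:: a; b; c; d]) nu (mem_head a _)) => x x_in x_max.
have [xa xb xc xd] : [/\ nu a <= nu x, nu b <= nu x, nu c <= nu x & nu d <= nu x].
  by split; apply: x_max; rewrite /= !inE eqxx ?orbT.
move: x_in xa xb xc xd; rewrite /= !inE.
by case/or4P => /eqP -> *;
  [apply: nmax abcd _ | apply: nmax bcda _ | apply: nmax cdab _ | apply: nmax dabc _].
Qed.

(** By completeness the non-edges [bc] and [da] of [part G s] have the opposite sign. *)
Lemma edge_pair_alternating s :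
  contains_induced_edge_pair (part G s) ->
  exists a b c d, alternating_cycle s a b c d.
Proof.
case=> a [b [c [d [ab cd dis nonadj]]]].
have neq x y : x \in [set a; b] -> y \in [set c; d] -> x != y.
  by move=> xab; apply: contraTneq => <-; rewrite (disjointFr dis).
exists a, b, c, d; split=> //; last rewrite adj_sym.
all: by rewrite partN ?neq ?nonadj // !inE eqxx ?orbT.
Qed.

Lemma path4_alternating s :
  contains_induced (part G s) (path_graph 4) ->
  exists a b c d, alternating_cycle s a b c d.
Proof.
case=> f [f_inj fE].
pose v k (lt_k : k < 4) := f (Ordinal lt_k).
(* The end edges 01 and 32 of the path alternate with its non-edges 13 and 20. *)
exists (@v 0 isT), (@v 1 isT), (@v 3 isT), (@v 2 isT).
by split; rewrite ?partN ?(inj_eq f_inj) // fE.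
Qed.

Lemma induced_path4 s a b c d :
    part G s a b -> part G s b c -> part G s c d ->
    part G (~~ s) a c -> part G (~~ s) b d -> part G (~~ s) a d ->
  contains_induced (part G s) (path_graph 4).
Proof.
move=> ab bc cd ac bd ad; exists (fun i : 'I_4 => nth a [:: a; b; c; d] i).
have uniq_abcd : uniq [:: a; b; c; d].
  by rewrite /= !inE !negb_or !(part_neq ab, part_neq bc, part_neq cd,
    part_neq ac, part_neq bd, part_neq ad).
split=> [i j /eqP|]; first by rewrite nth_uniq // => /eqP/val_inj.
have non x y : part G (~~ s) x y -> part G s x y = false.
  by move=> xy; apply/negbTE; rewrite -partN ?(part_neq xy).
have adjE := (ab, bc, cd, non _ _ ac, non _ _ bd, non _ _ ad, adj_irrefl (part G s)).
have sym := adj_sym (part G s).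
case=> [[|[|[|[|//]]]] lt_i] [[|[|[|[|//]]]] lt_j] /=;
  by rewrite /path_adj ?adjE // sym adjE.
Qed.

Lemma induced_edge_pair s a b c d :
    part G s a b -> part G s c d ->
    part G (~~ s) a c -> part G (~~ s) a d ->
    part G (~~ s) b c -> part G (~~ s) b d ->
  contains_induced_edge_pair (part G s).
Proof.
move=> ab cd ac ad bc bd; exists a, b, c, d.
have cross x y : x \in [set a; b] -> y \in [set c; d] -> part G (~~ s) x y.
  by move=> /set2P[] -> /set2P[] ->.
split=> // [|x y xab ycd].
  rewrite disjoint_subset; apply/subsetP => x xab; apply/negP => xcd.
  by have /part_neq := cross x x xab xcd; rewrite eqxx.
by rewrite -partN ?cross ?(part_neq (cross x y xab ycd)).
Qed.

(** If one diagonal has sign [s], it is the middle edge of a path joining [ab] and [cd]. If none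
    has, [ab] and [cd] form an edge pair; if both have, [bc] and [da] do so for [~~ s]. *)
Lemma alternating_cycle_induced s a b c d :
    alternating_cycle s a b c d ->
  exists t, contains_induced (part G t) (path_graph 4) \/
            contains_induced_edge_pair (part G t).
Proof.
move=> abcd.
have ac := alternating_cycle_diag abcd.
have bd := alternating_cycle_diag (alternating_cycle_rot abcd).
case: abcd => ab bc cd da.
have sym t := adj_sym (part G t).
have := partN s ac; have := partN s bd.
case Eac: (part G s a c); case Ebd: (part G s b d) => /= Nbd Nac.
- exists (~~ s); right; apply: (@induced_edge_pair _ b c d a);
    by rewrite ?negbK // sym.
- by exists s; left; apply: (@induced_path4 _ b a c d); rewrite // sym.
- by exists s; left; apply: (@induced_path4 _ a b d c); rewrite // sym.
- by exists s; right; apply: (@induced_edge_pair _ a b c d); rewrite // sym.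
Qed.

Hypothesis no_alternating :
  forall s a b c d, ~ alternating_cycle s a b c d.

(** The candidates are a vertex [v] of largest positive degree in [S] and a vertex [x] joined
    negatively to [v]; if both fail, a positive neighbour [y] of [x] leads to an alternating
    cycle. *)
Lemma monochromatic_vertex (S : {set V}) x0 :
  x0 \in S ->
  exists2 x, x \in S & exists s, {in S :\ x, forall v, part G s x v}.
Proof.
have symT := adj_sym (part G true).
have falseE u v : u != v -> part G false u v = ~~ part G true u v.
  exact: (partN true).
move=> x0S; pose N v := [set u in S | part G true v u].
case: (arg_maxnP (P := mem S) (fun v => #|N v|) x0S) => v vS v_max.
have [allv|] := boolP [forall x in S :\ v, part G true v x].
  by exists v => //; exists true; apply/forall_inP.
rewrite negb_forall_in => /exists_inP[x /setD1P[xv xS] vx].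
have [allx|] := boolP [forall y in S :\ x, part G false x y].
  by exists x => //; exists false; apply/forall_inP.
rewrite negb_forall_in => /exists_inP[y /setD1P[yx yS]].
rewrite falseE 1?eq_sym // negbK => xy.
have yv : y != v by apply: contraTneq xy => ->; rewrite symT.
(* As [x] is in [N y] but not in [N v] and [v] has the larger degree, some
   [z != y] is in [N v] but not in [N y]; then [v], [z], [y], [x] alternate. *)
have [z] : exists z, z \in (N v :\ y) :\: (N y :\ v).
  apply/set0Pn; rewrite setD_eq0; apply/negP => sub.
  have : #|N v :\ y| < #|N y :\ v|.
    apply/proper_card/properP; split=> //; exists x.
      by rewrite !inE xv xS symT xy.
    by rewrite !inE (negbTE vx) !andbF.
  (* The edge [vy] counts equally in both degrees, so adding it back contradicts the maximality of
     [v]. *)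
  rewrite -(ltn_add2l (part G true y v)).
  have := v_max y yS; rewrite (cardsD1 y (N v)) (cardsD1 v (N y)).
  by rewrite !inE yS (vS : v \in S) (symT v y) /= leqNgt => /negP.
rewrite !inE => /andP[+ /and3P[zy zS vz]].
rewrite zS eq_sym (part_neq vz) /= => nyz.
case: (@no_alternating true v z y x); split=> //=.
- by rewrite falseE // symT.
- by rewrite symT.
- by rewrite falseE // symT.
Qed.

(** By induction: a monochromatic vertex of [S] gets rank 0, and the ranks of the others shift up by
    one. *)
Lemma monochromatic_ranking (S : {set V}) :
  exists r : V -> nat,
    [/\ {in S, forall u, r u < #|S|}, {in S &, injective r} &
        {in S, forall u, exists s, {in S, forall v, r u < r v -> part G s u v}}].
Proof.
have [n] := ubnP #|S|; elim: n S => // n IHn S /ltnSE leSn.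
have [->|[x0 /monochromatic_vertex[x xS [s xs]]]] := set_0Vmem S.
  by exists (fun=> 0); split=> [u|u v|u]; rewrite inE.
have cardS : #|S| = #|S :\ x|.+1 by rewrite (cardsD1 x) xS.
have [|r [r_lt r_inj r_mono]] := IHn (S :\ x); first by rewrite -cardS.
exists (fun v => if v == x then 0 else (r v).+1); split=> [u uS|u v uS vS|u uS].
- by rewrite cardS; case: eqP => //= /eqP ux; rewrite ltnS r_lt // !inE ux.
- case: (eqVneq u x) => [->|ux]; case: (eqVneq v x) => [->|vx] // [].
  by apply: r_inj; rewrite !inE ?ux ?vx.
case: (eqVneq u x) => [->|ux].
  exists s => v vS; case: eqP => // /eqP vx _; apply: xs.
  by rewrite !inE vx.
have [|t ut] := r_mono u; first by rewrite !inE ux.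
exists t => v vS; case: eqP => // /eqP vx ruv; apply: ut => //.
by rewrite !inE vx.
Qed.

Lemma no_alternating_cycle_eliminable : signed_eliminable G.
Proof.
have [r [r_lt r_inj r_mono]] := monochromatic_ranking [set: V].
have lt_r v : r v < #|V| by rewrite -cardsT r_lt.
exists (fun v => Ordinal (lt_r v)); split.
  apply: inj_card_bij; last by rewrite card_ord.
  by move=> u v [/r_inj-> //]; rewrite inE.
move=> u v w /= /andP[]; rewrite !inE negb_or => /andP[uv _] _ uw vw s.
have mono a : exists t, forall b, r a < r b -> part G t a b.
  by have [|t at_] := r_mono a; [rewrite inE | exists t => b; apply: at_; rewrite inE].
have sym t := adj_sym (part G t).
(* The earlier of [u] and [v] sends edges of one sign to the other two vertices. If it is [v], the
   premises of (E2) contradict each other. *)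
case: (ltngtP (r u) (r v)) => [ruv|rvu|/r_inj E]; last first.
- by rewrite E ?eqxx ?inE in uv.
- have [t vt] := mono v; split=> [_ wv|Euv Evw].
    have Evw : part G s v w by rewrite sym.
    by rewrite sym (part_sign_inj Evw (vt _ vw)) vt.
  have Evu : part G s v u by rewrite sym.
  have := part_sign_inj Evu (vt _ rvu); have := part_sign_inj Evw (vt _ vw).
  by move=> <-; case: (s).
- have [t ut] := mono u; split=> [Euw _|Euv _].
    by rewrite (part_sign_inj Euw (ut _ uw)) ut.
  by rewrite (part_sign_inj Euv (ut _ ruv)) ut.
Qed.

End SignedGraphs.

Theorem corollary6p4 (V : finType) (G : signed_graph V)
    (complete_G : complete_graph (unsigned G)) :
  signed_eliminable G <->
  forall s : sign,
    ~ contains_induced (part G s) (path_graph 4) /\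
    ~ contains_induced_edge_pair (part G s).
Proof.
split=> [[nu seo] s|free].
  have no_alt : ~ exists a b c d, alternating_cycle G s a b c d.
    by case=> a [b [c [d]]]; apply: SEO_no_alternating_cycle seo.
  split; first by move/(path4_alternating complete_G).
  by move/(edge_pair_alternating complete_G).
apply: no_alternating_cycle_eliminable => // s a b c d.
move=> /(alternating_cycle_induced complete_G)[t].
by have [noP noE] := free t; case.
Qed.
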